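(* Every closed $\widetilde{\mathbb{C}}$-linear map from a barrelled $\widetilde{\mathbb{C}}$-module $(\mathcal{G},\tau_1)$ to an infra-s $\widetilde{\mathbb{C}}$-module $(\mathcal{F},\tau_2)$ is continuous.
   Context: A map is closed if its graph is closed in the product space $\mathcal{G}\times\mathcal{F}$. ''Coarser'' and ''finer'' are meant non-strictly; $\tau\prec\tau'$ means that $\tau$ is coarser than $\tau'$. Generalized numbers: $\widetilde{\mathbb{C}}=\mathcal{E}_M/\mathcal{N}$, where $\mathcal{E}_M$ is the ring of nets $(c_\varepsilon)_\varepsilon\in\mathbb{C}^{(0,1]}$ with $|c_\varepsilon|=O(\varepsilon^{-N})$ as $\varepsilon\to0$ for some $N\in\mathbb{N}$, and $\mathcal{N}$ is the ideal of nets with $|c_\varepsilon|=O(\varepsilon^{q})$ for all $q\in\mathbb{N}$; $[(c_\varepsilon)_\varepsilon]$ denotes the class of $(c_\varepsilon)_\varepsilon$. The valuation is $\mathrm{v}(c)=\sup\{b\in\mathbb{R}: |c_\varepsilon|=O(\varepsilon^b)\text{ as }\varepsilon\to0\}$ and $|c|_{\mathrm e}=e^{-\mathrm{v}(c)}$; $\widetilde{\mathbb{C}}$ carries the topology of the ultrametric $|c-d|_{\mathrm e}$. A topological $\widetilde{\mathbb{C}}$-module is a $\widetilde{\mathbb{C}}$-module with a $\widetilde{\mathbb{C}}$-linear topology, i.e. one making addition and scalar multiplication $\widetilde{\mathbb{C}}\times\mathcal{G}\to\mathcal{G}$ continuous. A subset $A$ of a $\widetilde{\mathbb{C}}$-module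 $\mathcal{G}$ is balanced if $\lambda A\subseteq A$ whenever $|\lambda|_{\mathrm e}\le1$; absorbent if for every $u\in\mathcal{G}$ there is $a\in\mathbb{R}$ with $u\in[(\varepsilon^b)_\varepsilon]A$ for all $b\le a$. A string in $\mathcal{G}$ is a sequence $(U_n)_{n\ge1}$ of balanced and absorbent subsets of $\mathcal{G}$ (its knots) with $U_{n+1}+U_{n+1}\subseteq U_n$ for all $n$ and $[(\varepsilon^{-n})_\varepsilon]U_{n+p}\subseteq U_p$ for all $n,p\ge1$. In a topological $\widetilde{\mathbb{C}}$-module a string is closed if every knot is closed, and topological if every knot is a neighborhood of $0$. A topological $\widetilde{\mathbb{C}}$-module (or its topology) is barrelled if every closed string in it is topological. For a $\widetilde{\mathbb{C}}$-linear topology $\tau$ on $\mathcal{F}$, the associated barrelled topology $\tau^t$ is the coarsest barrelled $\widetilde{\mathbb{C}}$-linear topology on $\mathcal{F}$ finer than $\tau$ (it exists). A Hausdorff topological $\widetilde{\mathbb{C}}$-module $(\mathcal{F},\tau_0)$ is an infra-s $\widetilde{\mathbb{C}}$-module if for every Hausdorff $\widetilde{\mathbb{C}}$-linear topology $\tau$ on $\mathcal{F}$ coarser than $\tau_0$ one has $\tau_0\prec\tau^t$. *)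

(* Defs.v *)
From HB Require Import structures.
From mathcomp Require Import all_boot all_order all_algebra ring_quotient.
From mathcomp Require Import all_classical all_reals.
From mathcomp Require Import ereal topology normedtype sequences exp.
From mathcomp Require Import complex.

Set Implicit Arguments.
Unset Strict Implicit.
Unset Printing Implicit Defensive.

Import Order.TTheory GRing.Theory Num.Theory Normc.
Import numFieldNormedType.Exports.

Local Open Scope classical_set_scope.
Local Open Scope ring_scope.
Local Open Scope quotient_scope.

Definition I01 (R : realType) := {e : R | 0 < e <= 1}.

Section I01.
Context {R : realType}.

HB.instance Definition _ := Choice.on (I01 R).

Lemma I01_1_subproof : 0 < (1 : R) <= 1.
Proof. by rewrite ltr01 lexx. Qed.

Definition I01_1 : I01 R := exist _ 1 I01_1_subproof.

HB.instance Definition _ := isPointed.Build (I01 R) I01_1.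

End I01.

Definition net (R : realType) := I01 R -> R[i].

HB.instance Definition _ (R : realType) :=
  GRing.ComNzRing.copy (net R) (I01 R -> R[i]).

Section growth.
Context {R : realType}.
Implicit Types (c d : net R) (b : R).

(* |c_e| = O(e ^ b) as e -> 0 *)
Definition bigO_pow c b : Prop :=
  exists M eta : R, 0 < eta /\
    forall e : I01 R, val e <= eta -> normc (c e) <= M * val e `^ b.

Definition is_moderate c : Prop := exists N : nat, bigO_pow c (- N%:R).

Definition is_negligible c : Prop := forall q : nat, bigO_pow c q%:R.

Definition moderate : {pred net R} := fun c => `[< is_moderate c >].

Lemma I01_gt0 (e : I01 R) : 0 < val e.
Proof. by case/andP: (valP e). Qed.

Lemma I01_le1 (e : I01 R) : val e <= 1.
Proof. by case/andP: (valP e). Qed.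

Lemma normc_ge0 (z : R[i]) : 0 <= normc z.
Proof. by case: z => x y; rewrite /= sqrtr_ge0. Qed.

Lemma bigO_powP c b : bigO_pow c b ->
  exists M eta : R, [/\ 0 <= M, 0 < eta &
    forall e : I01 R, val e <= eta -> normc (c e) <= M * val e `^ b].
Proof.
move=> [M [eta [eta0 cM]]]; exists `|M|, eta; split=> // e /cM /le_trans; apply.
by rewrite ler_wpM2r ?powR_ge0// ler_norm.
Qed.

Lemma bigO_pow_le c b b' : b' <= b -> bigO_pow c b -> bigO_pow c b'.
Proof.
move=> b'b /bigO_powP[M [eta [M0 eta0 cM]]]; exists M, eta; split=> // e /cM.
by move=> /le_trans; apply; rewrite ler_wpM2l// ger_powR// (valP e).
Qed.

Lemma bigO_pow0 b : bigO_pow 0 b.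
Proof.
exists 0, 1; split=> // e _; rewrite mul0r.
by change (0 e) with (0 : R[i]); rewrite normc0.
Qed.

Lemma bigO_powN c b : bigO_pow c b -> bigO_pow (- c) b.
Proof.
move=> [M [eta [eta0 cM]]]; exists M, eta; split=> // e /cM.
by change ((- c) e) with (- c e); rewrite normcN.
Qed.

Lemma bigO_powD c d b : bigO_pow c b -> bigO_pow d b -> bigO_pow (c + d) b.
Proof.
move=> [M [eta [eta0 cM]]] [M' [eta' [eta'0 dM]]].
exists (M + M'), (Num.min eta eta'); split; first by rewrite lt_min eta0.
move=> e; rewrite le_min => /andP[/cM ce /dM de].
change ((c + d) e) with (c e + d e).
by rewrite (le_trans (le_normcD _ _))// mulrDl lerD.
Qed.

Lemma bigO_powM c d b b' :
  bigO_pow c b -> bigO_pow d b' -> bigO_pow (c * d) (b + b').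
Proof.
move=> [M [eta [eta0 cM]]] [M' [eta' [eta'0 dM]]].
exists (M * M'), (Num.min eta eta'); split; first by rewrite lt_min eta0.
move=> e; rewrite le_min => /andP[/cM ce /dM de].
change ((c * d) e) with (c e * d e).
rewrite normcM powRD; last by apply/implyP => _; rewrite gt_eqF ?I01_gt0.
by rewrite mulrACA ler_pM// normc_ge0.
Qed.

Lemma moderate_subring_closed : subring_closed moderate.
Proof.
split=> [|c d|c d].
- apply/asboolP; exists 0%N, 1, 1; split=> // e _.
  by change (1 e) with (1 : R[i]); rewrite normc1 oppr0 powRr0 mulr1.
- move=> /asboolP[N cN] /asboolP[N' dN]; apply/asboolP; exists (N + N')%N.
  by apply: bigO_powD; [apply: bigO_pow_le cN|apply: bigO_powN;
    apply: bigO_pow_le dN]; rewrite lerN2 ler_nat ?leq_addr ?leq_addl.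
- move=> /asboolP[N cN] /asboolP[N' dN]; apply/asboolP; exists (N + N')%N.
  by rewrite natrD opprD; apply: bigO_powM.
Qed.

HB.instance Definition _ :=
  GRing.isSubringClosed.Build (net R) moderate moderate_subring_closed.

End growth.

Record moderate_net (R : realType) := ModerateNet {
  net_of :> net R ;
  net_of_moderate : net_of \in moderate
}.

Section moderate_net.
Context {R : realType}.

HB.instance Definition _ := [isSub for @net_of R].
HB.instance Definition _ := [Choice of moderate_net R by <:].
HB.instance Definition _ := [SubChoice_isSubComNzRing of moderate_net R by <:].

Definition negligible : {pred moderate_net R} :=
  fun c => `[< is_negligible c >].

Lemma negligible_idealr_closed : idealr_closed negligible.
Proof.
split=> [| |a c d].
- by apply/asboolP => q; exact: bigO_pow0.
- apply/asboolP => /(_ 1%N) /bigO_powP[M [eta [M0 eta0 H]]].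
  pose x : R := Num.min 1 (Num.min eta (M + 1)^-1 / 2).
  have M1 : 0 < M + 1 by rewrite ltr_wpDl.
  have m0 : 0 < Num.min eta (M + 1)^-1 by rewrite lt_min eta0 invr_gt0.
  have x01 : 0 < x <= 1 by rewrite lt_min ltr01 divr_gt0//= ge_min lexx.
  have xm : x < Num.min eta (M + 1)^-1.
    by rewrite gt_min ltr_pdivrMr// ltr_pMr// ltr1n orbT.
  move: xm; rewrite lt_min => /andP[/ltW xeta xM].
  have := H (exist _ x x01) xeta.
  change (normc (1 : R[i]) <= M * x `^ 1 -> False).
  case/andP: (x01) => x0 _; rewrite normc1 powRr1; last exact: ltW.
  rewrite leNgt => /negP; apply.
  rewrite (@le_lt_trans _ _ ((M + 1) * x))//; first by rewrite ler_pM2r// lerDl.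
  by rewrite mulrC -ltr_pdivlMr// div1r.
- move=> /asboolP cN /asboolP dN; apply/asboolP => q.
  have /asboolP[N aN] := net_of_moderate a.
  apply: bigO_powD; last exact: dN.
  have -> : q%:R = - N%:R + (N + q)%:R :> R by rewrite natrD addKr.
  exact: bigO_powM aN (cN _).
Qed.

HB.instance Definition _ :=
  isIdealr.Build (moderate_net R) negligible negligible_idealr_closed.

End moderate_net.

Definition gencplx (R : realType) := {ideal_quot (@negligible R)}.

HB.instance Definition _ (R : realType) :=
  GRing.ComNzRing.copy (gencplx R) {ideal_quot (@negligible R)}.

Section gencplx.
Context {R : realType}.
Implicit Types (c d : moderate_net R) (x y z : gencplx R).

Definition gclass c : gencplx R := \pi_{ideal_quot (@negligible R)} c.

Lemma epow_moderate (b : R) :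
  ((fun e => (val e `^ b)%:C%C) : net R) \in moderate.
Proof.
apply/asboolP; exists (Num.truncn `|b|).+1, 1, 1; split=> // e _.
rewrite /= expr0n/= addr0 sqrtr_sqr ger0_norm ?powR_ge0// mul1r.
rewrite ger_powR ?(valP e)// lerNl (le_trans (ler_norm _))// normrN ltW//.
by rewrite truncnS_gt.
Qed.

Definition epow (b : R) : gencplx R := gclass (ModerateNet (epow_moderate b)).

Definition net_valuation (c : net R) : \bar R :=
  ereal_sup [set b%:E | b in [set b : R | bigO_pow c b]].

(* The choice of the representative is irrelevant by valuation_class. *)
Definition valuation (x : gencplx R) : \bar R :=
  net_valuation (repr x : moderate_net R).

(* |x|_e = e ^ (- v x); the valuation is never -oo, and it is +oo at 0, where
   expeR (- +oo) = 0. *)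
Definition enorm (x : gencplx R) : R := fine (expeR (- valuation x)%E).

Lemma gclass_eq c d : gclass c = gclass d <-> is_negligible (c - d).
Proof.
rewrite /gclass; split=> [/eqP|H].
  by rewrite -Quotient.idealrBE => /asboolP.
by apply/eqP; rewrite -Quotient.idealrBE; apply/asboolP.
Qed.

Lemma gclass_repr x : gclass (repr x) = x.
Proof. exact: reprK. Qed.

Lemma gclassD c d : gclass (c + d) = gclass c + gclass d.
Proof. exact: (rmorphD \pi_{ideal_quot (@negligible R)}). Qed.

Lemma gclassB c d : gclass (c - d) = gclass c - gclass d.
Proof. exact: (rmorphB \pi_{ideal_quot (@negligible R)}). Qed.

Lemma gclass0 : gclass 0 = 0.
Proof. exact: (rmorph0 \pi_{ideal_quot (@negligible R)}). Qed.

Lemma bigO_pow_negligible (c d : net R) (b : R) :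
  is_negligible (c - d) -> bigO_pow d b -> bigO_pow c b.
Proof.
move=> cd db; rewrite -(subrK d c); apply: bigO_powD => //.
apply: bigO_pow_le (cd (Num.truncn `|b|).+1).
by rewrite (le_trans (ler_norm _))// ltW// truncnS_gt.
Qed.

Lemma valuation_class c : valuation (gclass c) = net_valuation c.
Proof.
have cr : is_negligible (c - repr (gclass c)).
  by apply/gclass_eq; rewrite gclass_repr.
have rc : is_negligible (repr (gclass c) - c).
  by apply/gclass_eq; rewrite gclass_repr.
rewrite /valuation /net_valuation; congr (ereal_sup [set _%:E | _ in _]).
by apply/seteqP; split=> b /=; apply: bigO_pow_negligible.
Qed.

Lemma valuation_gtNy x : (-oo < valuation x)%E.
Proof.
have /asboolP[N xN] := net_of_moderate (repr x).
apply: (@lt_le_trans _ _ (- N%:R)%:E); first by rewrite ltNyr.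
by apply: ereal_sup_ubound; exists (- N%:R).
Qed.

Lemma valuation0 : valuation 0 = +oo%E.
Proof.
rewrite -gclass0 valuation_class; apply/eqyP => A _.
by apply: ereal_sup_ubound; exists A => //; exact: bigO_pow0.
Qed.

Lemma valuation_eqy x : valuation x = +oo%E -> x = 0.
Proof.
move=> vx; rewrite -(gclass_repr x) -gclass0; apply/gclass_eq => q.
rewrite subr0; have : (q%:R%:E < valuation x)%E by rewrite vx ltry.
move=> /ereal_sup_gt[_ [b xb <-]]; rewrite lte_fin => /ltW qb.
exact: bigO_pow_le xb.
Qed.

Lemma valuationN x : valuation (- x) = valuation x.
Proof.
rewrite -(gclass_repr x) -[X in valuation X]sub0r -gclass0 -gclassB !sub0r.
rewrite !valuation_class /net_valuation; congr (ereal_sup [set _%:E | _ in _]).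
apply/seteqP; split=> b /= /bigO_powN //.
by change (bigO_pow (- - (repr x : net R)) b -> bigO_pow (repr x) b);
  rewrite opprK.
Qed.

Lemma valuationD x y :
  (Order.min (valuation x) (valuation y) <= valuation (x + y)%R)%E.
Proof.
have -> : valuation (x + y) = net_valuation (repr x + repr y : moderate_net R).
  by rewrite -valuation_class gclassD !gclass_repr.
rewrite leNgt; apply/negP; rewrite lt_min => /andP[].
move=> /ereal_sup_gt[_ [b xb <-] sb] /ereal_sup_gt[_ [b' yb' <-] sb'].
have : ((Num.min b b')%:E <=
    net_valuation (repr x + repr y : moderate_net R)%R)%E.
  apply: ereal_sup_ubound; exists (Num.min b b') => //; apply: bigO_powD.
    by apply: bigO_pow_le xb; rewrite ge_min lexx.
  by apply: bigO_pow_le yb'; rewrite ge_min lexx orbT.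
by rewrite leNgt EFin_min lt_min sb sb'.
Qed.

Lemma enorm_ge0 x : 0 <= enorm x.
Proof. by rewrite /enorm fine_ge0// expeR_ge0. Qed.

Lemma enorm0 : enorm 0 = 0.
Proof. by rewrite /enorm valuation0. Qed.

Lemma enorm0_eq0 x : enorm x = 0 -> x = 0.
Proof.
rewrite /enorm; have := valuation_gtNy x; have := @valuation_eqy x.
by case: (valuation x) => [v _ _|-> //|//] /= /eqP; rewrite gt_eqF ?expR_gt0.
Qed.

Lemma enormN x : enorm (- x) = enorm x.
Proof. by rewrite /enorm valuationN. Qed.

Lemma enormD x y : enorm (x + y) <= Num.max (enorm x) (enorm y).
Proof.
have homo_e (u v : \bar R) : (-oo < u)%E -> (u <= v)%E ->
    fine (expeR (- v)%E) <= fine (expeR (- u)%E).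
  case: u v => [u||] [v||]//= _; rewrite ?lexx ?expR_ge0//.
  by rewrite lee_fin ler_expR lerN2.
have := valuationD x y; rewrite ge_min le_max => /orP[] /homo_e ->;
  by rewrite ?orbT ?valuation_gtNy.
Qed.

Definition edist x y : R := enorm (x - y).

Lemma edistxx x : edist x x = 0.
Proof. by rewrite /edist subrr enorm0. Qed.

Lemma edist_positivity x y : edist x y = 0 -> x = y.
Proof. by move=> /enorm0_eq0/eqP; rewrite subr_eq0 => /eqP. Qed.

Lemma edist_sym x y : edist x y = edist y x.
Proof. by rewrite /edist -opprB enormN. Qed.

Lemma edist_triangle y x z : edist x z <= edist x y + edist y z.
Proof.
rewrite /edist -[x - z](subrKA y) (le_trans (enormD _ _))//.
by rewrite ge_max lerDl lerDr !enorm_ge0.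
Qed.

HB.instance Definition _ := isMetric.Build R (gencplx R)
  edistxx edist_positivity edist_sym edist_triangle.

End gencplx.

(* Several topologies on the same module have to be compared, so a topology is
   a first-class object here; carrier tau is T equipped with tau. *)
Record topology (T : Type) := Topology {
  opens : set (set T) ;
  opensT : opens setT ;
  opensI : setI_closed opens ;
  opens_bigU : forall (I : Type) (f : I -> set T),
    (forall i, opens (f i)) -> opens (\bigcup_i f i)
}.

Definition carrier (T : choiceType) (tau : topology T) : Type := T.

HB.instance Definition _ (T : choiceType) (tau : topology T) :=
  Choice.copy (carrier tau) T.

HB.instance Definition _ (T : choiceType) (tau : topology T) :=
  isOpenTopological.Build (carrier tau)
    (opensT tau) (@opensI _ tau) (@opens_bigU _ tau).

Definition coarser (T : Type) (tau tau' : topology T) : Prop :=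
  opens tau `<=` opens tau'.

Definition hausdorff (T : choiceType) (tau : topology T) : Prop :=
  hausdorff_space (carrier tau).

Definition continuous_for (S T : choiceType)
    (sigma : topology S) (tau : topology T) (f : S -> T) : Prop :=
  continuous (f : carrier sigma -> carrier tau).

Definition closed_map (S T : choiceType)
    (sigma : topology S) (tau : topology T) (f : S -> T) : Prop :=
  closed [set z : carrier sigma * carrier tau | z.2 = f z.1].

Section modules.
Context {R : realType} {G : lmodType (gencplx R)}.
Implicit Types (A : set G) (U : nat -> set G) (tau : topology G).

Definition balanced A : Prop :=
  forall (l : gencplx R) (u : G), enorm l <= 1 -> A u -> A (l *: u).

Definition absorbent A : Prop :=
  forall u : G, exists a : R, forall b : R, b <= a ->
    [set epow b *: v | v in A] u.

(* The knots are the U n with 1 <= n; U 0 is not part of the string. *)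
Definition string U : Prop :=
  [/\ forall n, (0 < n)%N -> balanced (U n) /\ absorbent (U n),
      forall n, (0 < n)%N -> [set u + v | u in U n.+1 & v in U n.+1] `<=` U n &
      forall n p, (0 < n)%N -> (0 < p)%N ->
        [set epow (- n%:R) *: u | u in U (n + p)%N] `<=` U p].

Definition closed_string tau U : Prop :=
  forall n, (0 < n)%N -> closed (U n : set (carrier tau)).

Definition topological_string tau U : Prop :=
  forall n, (0 < n)%N -> nbhs ((0 : G) : carrier tau) (U n).

Definition linear_topology tau : Prop :=
  continuous
    ((fun z => z.1 + z.2 : G) : carrier tau * carrier tau -> carrier tau) /\
  continuous
    ((fun z => z.1 *: (z.2 : G)) : gencplx R * carrier tau -> carrier tau).

Definition barrelled tau : Prop :=
  linear_topology tau /\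
  forall U, string U -> closed_string tau U -> topological_string tau U.

(* taut is the coarsest barrelled linear topology finer than tau. It exists and
   is unique, so quantifying over all such taut in infra_s amounts to speaking
   of the associated barrelled topology of tau. *)
Definition associated_barrelled tau taut : Prop :=
  [/\ barrelled taut, coarser tau taut &
      forall sigma, barrelled sigma -> coarser tau sigma -> coarser taut sigma].

Definition infra_s tau0 : Prop :=
  [/\ linear_topology tau0, hausdorff tau0 &
      forall tau, linear_topology tau -> hausdorff tau -> coarser tau tau0 ->
      forall taut, associated_barrelled tau taut -> coarser tau0 taut].

End modules.

(* Main.v *)
Require Import Defs.
From HB Require Import structures.
From mathcomp Require Import all_boot all_order all_algebra.
From mathcomp Require Import all_classical all_reals topology ereal.
From mathcomp Require Import normedtype sequences exp complex.

Set Implicit Arguments.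
Unset Strict Implicit.
Unset Printing Implicit Defensive.
Import Order.TTheory GRing.Theory Num.Theory Normc.
Local Open Scope classical_set_scope.
Local Open Scope ring_scope.

(** Let f be a closed linear map from the barrelled module (G, tau1) to the
    infra-s module (F, tau2).

    The sets f(U) + V, with U a neighborhood of 0 for tau1 and V one for tau2,
    form a base of neighborhoods of 0 of a linear topology tau on F, the finest
    one that is coarser than tau2 and makes f continuous. A point x that lies
    in every f(U) + V is such that (0, x) adheres to the graph of f; as the
    graph is closed, x = f 0 = 0. Hence tau is Hausdorff
    (sum_topology_hausdorff), and since tau2 is infra-s, tau2 is coarser than
    the barrelled topology associated with tau. It remains to see that this
    associated topology exists and that f is continuous for it.

    Both facts come from one construction. A linear topology is determined by
    its neighborhoods of 0, and the filters that occur in this way are the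
    linear filters below. Every filter E contains a greatest linear filter
    (linear_core E). The corresponding topology is barrelled as soon as E
    contains the knots of each string closed for it
    (core_topology_barrelled): a string generates a linear filter, so if its
    knots are in E then they are in the core of E.

    - Taking for E the sets that are neighborhoods of 0 for all barrelled
      topologies finer than tau, the core is the associated barrelled topology
      (associated_barrelled_exists).
    - Taking for E the sets whose inverse image by f is a neighborhood of 0
      for tau1, the core is the finest linear topology making f continuous.
      The inverse image of a closed string is a closed string of the barrelled
      module G, so this core is barrelled; it is finer than tau, hence finer
      than the topology associated with tau, for which f is therefore
      continuous (continuous_associated_barrelled). *)

(** * Powers of epsilon and the sharp norm *)

Section gencplx.
Context {R : realType}.
Implicit Types (x : gencplx R) (b : R).

Lemma gclassM (c d : moderate_net R) : gclass (c * d) = gclass c * gclass d.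
Proof. exact: (rmorphM \pi_{ideal_quot (@negligible R)}%qT). Qed.

Lemma epow_bigO b : bigO_pow (fun e : I01 R => (val e `^ b)%:C%C) b.
Proof.
exists 1, 1; split=> // e _.
by rewrite /= expr0n/= addr0 sqrtr_sqr ger0_norm ?powR_ge0// mul1r.
Qed.

Lemma epow0 : epow 0 = 1 :> gencplx R.
Proof.
rewrite -(rmorph1 \pi_{ideal_quot (@negligible R)}%qT).
congr gclass; apply: val_inj; apply/funext => e /=.
by rewrite powRr0.
Qed.

Lemma epowD b b' : epow (b + b') = epow b * epow b' :> gencplx R.
Proof.
rewrite -gclassM; congr gclass; apply: val_inj; apply/funext => e /=.
rewrite powRD; last by apply/implyP => _; rewrite gt_eqF ?I01_gt0.
by rewrite rmorphM.
Qed.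

Lemma epowVK b : epow b * epow (- b) = 1 :> gencplx R.
Proof. by rewrite -epowD subrr epow0. Qed.

(** The valuation is a supremum that need not be attained, hence the strict
    inequality: it leaves room for a larger exponent. *)
Lemma enorm_lt_bigO x b :
  enorm x < expR b -> bigO_pow (repr x : moderate_net R) (- b).
Proof.
move=> xb; have : ((- b)%:E < valuation x)%E.
  move: xb; rewrite /enorm; case: (valuation x) (valuation_gtNy x) => //=.
    by move=> v _; rewrite ltr_expR lte_fin ltrNl.
  by rewrite ltry.
move=> /ereal_sup_gt[_ [b' xb' <-]]; rewrite lte_fin => /ltW bb'.
exact: bigO_pow_le xb'.
Qed.

Lemma bigO_enorm_le1 (c : moderate_net R) :
  bigO_pow c 0 -> enorm (gclass c) <= 1.
Proof.
move=> c0; have : (0 <= valuation (gclass c))%E.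
  by rewrite valuation_class; apply: ereal_sup_ubound; exists 0.
rewrite /enorm; case: (valuation _) => [v| |]//=.
by rewrite lee_fin => v0; rewrite -expR0 ler_expR oppr_le0.
Qed.

(** Multiplication by epsilon to the power b brings a ball of radius exp b
    into the unit ball; this is how smallness of scalars meets absorbent and
    balanced sets, whose definitions involve powers of epsilon and the unit
    ball respectively. *)
Lemma enorm_mul_epow x b : enorm x < expR b -> enorm (x * epow b) <= 1.
Proof.
move=> /enorm_lt_bigO xb.
rewrite -(gclass_repr x) -gclassM; apply: bigO_enorm_le1.
by have := bigO_powM xb (epow_bigO b); rewrite addNr.
Qed.

Lemma nbhs_enorm x (P : set (gencplx R)) :
  nbhs x P <-> exists2 d : R, 0 < d & forall y, enorm (y - x) < d -> P y.
Proof.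
split=> [/nbhs_ballP[d /= d0 dP]|[d d0 dP]].
  exists d => // y yd; apply: dP; rewrite ballEmdist.
  by change (Defs.edist x y < d); rewrite Defs.edist_sym.
apply/nbhs_ballP; exists d => //= y.
by rewrite ballEmdist => xy; apply: dP; move: xy;
  change (Defs.edist x y < d -> Defs.edist y x < d); rewrite Defs.edist_sym.
Qed.

End gencplx.

(** * Linear topologies and their filters of neighborhoods of 0 *)

Lemma nbhs_carrierE (T : choiceType) (tau : topology T) (x : T) (V : set T) :
  nbhs (x : carrier tau) V <-> exists O, [/\ opens tau O, O x & O `<=` V].
Proof.
rewrite nbhsE; split=> [[O [oO Ox] OV]|[O [oO Ox OV]]]; first by exists O.
by exists O.
Qed.

Section linear_filter.
Context {R : realType} {G : lmodType (gencplx R)}.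
Implicit Types (N : set_system G) (V W : set G) (x y : G) (l m : gencplx R).

(** The filters of neighborhoods of 0 of the linear topologies. The last three
    conditions are the continuity of (l, x) |-> l *: x at (0, x), (l, 0) and
    (0, 0), from which its continuity at (l, x) follows by expanding
    m *: y = (l + (m - l)) *: (x + (y - x)). *)
Record linear_filter N : Prop := LinearFilter {
  linear_filter_filter :> Filter N ;
  linear_filter_mem0 : forall V, N V -> V 0 ;
  linear_filter_half : forall V, N V ->
    exists2 W, N W & forall x y, W x -> W y -> V (x + y) ;
  linear_filter_absorb : forall V x, N V ->
    nbhs (0 : gencplx R) [set l | V (l *: x)] ;
  linear_filterZ : forall V l, N V -> N [set x | V (l *: x)] ;
  linear_filter_nearZ : forall V, N V -> exists2 W, N W &
    nbhs (0 : gencplx R) [set l | forall x, W x -> V (l *: x)]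
}.

Section translation_topology.
Variables (N : set_system G) (linN : linear_filter N).
Let FN : Filter N := linN.
Local Existing Instance FN.

Let opens_translation : set (set G) :=
  [set O | forall x, O x -> N [set y | O (x + y)]].

Lemma translation_opensT : opens_translation setT.
Proof. by move=> x _; exact: filterT. Qed.

Lemma translation_opensI : setI_closed opens_translation.
Proof. by move=> A B oA oB x [/oA NA /oB NB]; exact: filterI. Qed.

Lemma translation_opens_bigU (I : Type) (f : I -> set G) :
  (forall i, opens_translation (f i)) -> opens_translation (\bigcup_i f i).
Proof.
move=> fo x [i _ /fo]; apply: filterS => y fxy; by exists i.
Qed.

Definition translation_topology : topology G :=
  Topology translation_opensT translation_opensI translation_opens_bigU.

(** The set of all z such that V - z is in N is open, thanks to
    linear_filter_half; so each translate of a member of N contains an open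
    set around the translated origin. *)
Lemma nbhs_translation x V :
  nbhs (x : carrier translation_topology) V <-> N [set y | V (x + y)].
Proof.
split.
  move=> /nbhs_carrierE[O [oO Ox OV]].
  by apply: filterS (oO _ Ox) => y; exact: OV.
move=> NV; apply/nbhs_carrierE; exists [set z | N [set y | V (z + y)]].
split=> [||z /(linear_filter_mem0 linN)]/=; rewrite ?addr0//.
move=> z /(linear_filter_half linN)[W NW WV].
apply: filterS (NW) => y Wy /=; apply: filterS NW => w Ww /=.
by rewrite -addrA; exact: WV.
Qed.

Lemma translation_linear : linear_topology translation_topology.
Proof.
split.
  move=> [x y] A /nbhs_translation /(linear_filter_half linN)[W NW WA].
  exists ([set z | W (z - x)], [set z | W (z - y)]).
    split=> /=; apply/nbhs_translation; apply: filterS NW => w /=;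
      by rewrite [_ + w - _]addrC addKr.
  move=> [u v] /= [Wu Wv]; have := WA _ _ Wu Wv.
  by rewrite /= addrACA !subrKC.
move=> [l x] A /nbhs_translation /(linear_filter_half linN)[W NW WA].
have [W' NW' WW'] := linear_filter_half linN NW.
have [Z NZ ZW'] := linear_filter_nearZ linN NW'.
have [d d0 dW] :=
  (nbhs_enorm _ _).1 (filterI (linear_filter_absorb linN x NW) ZW').
exists ([set m | enorm (m - l) < d],
        [set y | Z (y - x) /\ W' (l *: (y - x))]).
  split=> /=; first by apply/nbhs_enorm; exists d.
  apply/nbhs_translation.
  apply: filterS (filterI NZ (linear_filterZ linN l NW')) => w /=.
  by rewrite [x + w]addrC addrK.
move=> [m y] /= [ml [Zy W'y]].
have [Wx ZW] : W ((m - l) *: x) /\ forall x, Z x -> W' ((m - l) *: x).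
  by apply: dW; rewrite subr0.
have := WA _ _ Wx (WW' _ _ W'y (ZW _ Zy)).
by rewrite /= -scalerDl subrKC addrA -scalerDl subrKC -scalerDr subrKC.
Qed.

(** If every neighborhood of p meets every neighborhood of q, then q - p is a
    difference of two elements of W for each W in N, hence in every V in N. *)
Lemma translation_hausdorff :
  (forall x, (forall V, N V -> V x) -> x = 0) -> hausdorff translation_topology.
Proof.
move=> N0 p q pq; apply/esym/eqP; rewrite -subr_eq0; apply/eqP/N0 => V NV.
have [W NW WV] := linear_filter_half linN NV.
have [||z [/= Wp Wq]] := pq [set z | W (z - p)] [set z | W (- 1 *: (z - q))].
- apply/nbhs_translation; apply: filterS NW => w /=.
  by rewrite [p + _]addrC addrK.
- apply/nbhs_translation; apply: filterS (linear_filterZ linN (-1) NW) => w /=.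
  by rewrite [q + _]addrC addrK.
have := WV _ _ Wp Wq.
by rewrite scaleN1r opprB addrC subrKA.
Qed.

End translation_topology.

(** Both directions say that a translation is continuous: by x for the
    first one, and by - x for the second one. *)
Lemma nbhs_linear_translation (tau : topology G) x V : linear_topology tau ->
  nbhs (x : carrier tau) V <-> nbhs (0 : carrier tau) [set y | V (x + y)].
Proof.
have shift : linear_topology tau -> forall (x y : G) (V : set G),
    nbhs (x + y : carrier tau) V -> nbhs (y : carrier tau) [set z | V (x + z)].
  move=> [Dtau _] {}x y {}V /(Dtau (x, y))[[P Q] /= [Px Qy] PQ].
  apply: filterS Qy => z Qz; apply: (PQ (x, z)); split=> //=.
  exact: (@nbhs_singleton (carrier tau) x P Px).
move=> ltau; split=> [xV|].
  by apply: shift => //; rewrite addr0.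
rewrite -{1}(addNr x) => /(shift ltau); apply: filterS => z /=.
by rewrite addrA addrN add0r.
Qed.

Lemma linear_filter_nbhs (tau : topology G) : linear_topology tau ->
  linear_filter (nbhs (0 : carrier tau)).
Proof.
move=> [Dtau Ztau]; split.
- exact: (@nbhs_filter (carrier tau) (0 : G)).
- by move=> V; exact: (@nbhs_singleton (carrier tau)).
- move=> V V0.
  have /(Dtau (0, 0))[[P Q] /= [P0 Q0] PQ] :
    nbhs ((0 : G) + 0 : carrier tau) V by rewrite addr0.
  exists (P `&` Q); first exact: filterI.
  by move=> x y [Px _] [_ Qy]; exact: (PQ (x, y)).
- move=> V x V0.
  have /(Ztau (0, x))[[P Q] /= [P0 Qx] PQ] :
    nbhs (0 *: (x : G) : carrier tau) V by rewrite scale0r.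
  apply: filterS P0 => l Pl; apply: (PQ (l, x)); split=> //=.
  exact: (@nbhs_singleton (carrier tau) x Q Qx).
- move=> V l V0.
  have /(Ztau (l, 0))[[P Q] /= [Pl Q0] PQ] :
    nbhs (l *: (0 : G) : carrier tau) V by rewrite scaler0.
  apply: filterS Q0 => x Qx; apply: (PQ (l, x)); split=> //=.
  exact: nbhs_singleton Pl.
- move=> V V0.
  have /(Ztau (0, 0))[[P Q] /= [P0 Q0] PQ] :
    nbhs (0 *: (0 : G) : carrier tau) V by rewrite scale0r.
  exists Q => //; apply: filterS P0 => l Pl x Qx.
  exact: (PQ (l, x)).
Qed.

Lemma coarser_nbhs0 (tau tau' : topology G) :
    linear_topology tau -> linear_topology tau' ->
  coarser tau tau' <->
  (forall V, nbhs (0 : carrier tau) V -> nbhs (0 : carrier tau') V).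
Proof.
move=> ltau ltau'; split=> [tt' V|tt' O oO].
  move=> /nbhs_carrierE[O [/tt' oO O0 OV]].
  by apply/nbhs_carrierE; exists O.
suff : open (O : set (carrier tau')) by [].
rewrite openE => x Ox; apply/(nbhs_linear_translation x O ltau')/tt'.
apply/(nbhs_linear_translation x O ltau)/nbhs_carrierE.
by exists O; split=> //; exact: subset_refl.
Qed.

End linear_filter.

(** * The linear filter generated by a string *)

Section string_filter.
Context {R : realType} {G : lmodType (gencplx R)}.
Variables (U : nat -> set G) (strU : string U).

Definition string_filter : set_system G :=
  [set V | exists2 n, (0 < n)%N & U n `<=` V].

Lemma string0 n : (0 < n)%N -> U n 0.
Proof.
case: strU => bU _ _ /bU[Ubal /(_ 0)[a /(_ a (lexx _))[v Uv _]]].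
by rewrite -(scale0r v); apply: Ubal; rewrite // enorm0 ler01.
Qed.

Lemma string_le m n : (0 < n)%N -> (n <= m)%N -> U m `<=` U n.
Proof.
move=> n0 /subnK <-; elim: (m - n)%N => [//|k IHk] x Ux; apply: IHk.
case: strU => _ + _; apply; first by rewrite addn_gt0 n0 orbT.
by exists x => //; exists 0; [exact: string0|rewrite addr0].
Qed.

(** The knots of a string are a base of a linear filter. Absorbent knots
    give the continuity of l |-> l *: x at 0. The inclusions of the multiples
    of U (n + p) by a negative power of epsilon give that of x |-> l *: x,
    because every scalar l is such a power times a scalar of the unit ball. *)
Lemma string_filter_linear : linear_filter string_filter.
Proof.
have [bU hU mU] := strU; split.
- split.
  + by exists 1%N.
  + move=> A B [m m0 UA] [n n0 UB].
    exists (maxn m n); first by rewrite leq_max m0.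
    by move=> x Ux; split; [apply: UA|apply: UB]; apply: string_le Ux;
      rewrite // ?leq_maxl ?leq_maxr.
  + by move=> A B AB [n n0 UA]; exists n => //; exact: subset_trans UA AB.
- by move=> V [n n0 UV]; exact/UV/string0.
- move=> V [n n0 UV]; exists (U n.+1); first by exists n.+1.
  by move=> x y Ux Uy; apply/UV/hU => //; exists x => //; exists y.
- move=> V x [n n0 UV].
  have [Ubal /(_ x)[a /(_ a (lexx _))[v Uv <-]]] := bU _ n0.
  apply/nbhs_enorm; exists (expR a); first exact: expR_gt0.
  move=> l; rewrite subr0 => la /=; apply: UV; rewrite scalerA.
  exact/Ubal/Uv/enorm_mul_epow.
- move=> V l [n n0 UV]; pose N := (Num.truncn (enorm l)).+1.
  have lN : enorm l < expR N%:R.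
    rewrite (lt_le_trans (truncnS_gt _))// (le_trans _ (expR_ge1Dx _))//.
    by rewrite lerDr.
  exists (N + n)%N => // x Ux; apply: UV.
  (* l = (l epsilon^N) epsilon^(-N), with l epsilon^N in the unit ball *)
  rewrite -[l]mulr1 -(epowVK N%:R) mulrA -scalerA; apply: (bU _ n0).1.
    exact: enorm_mul_epow.
  by apply: (mU N) => //; exists x.
- move=> V [n n0 UV]; exists (U n); first by exists n.
  apply/nbhs_enorm; exists 1 => // l; rewrite subr0 => /ltW l1 x Ux.
  exact/UV/(bU _ n0).1.
Qed.

End string_filter.

(** * The greatest linear filter inside a filter *)

Section linear_core.
Context {R : realType} {G : lmodType (gencplx R)}.
Variables (E : set_system G) (FE : Filter E).

(** The union of the linear filters inside E. It is closed under finite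
    intersections because the join of two linear filters inside E is again
    one, and the other conditions pass to unions. *)
Definition linear_core : set_system G :=
  [set V | exists N, [/\ linear_filter N, N `<=` E & N V]].

Let join (M N : set_system G) : set_system G :=
  [set X | exists A B, [/\ M A, N B & A `&` B `<=` X]].

Let join_linear M N :
  linear_filter M -> linear_filter N -> linear_filter (join M N).
Proof.
move=> linM linN; have FM : Filter M := linM; have FN : Filter N := linN.
split.
- split.
  + by exists setT, setT; split=> //; exact: filterT.
  + move=> X Y [A [B [MA NB ABX]]] [A' [B' [MA' NB' ABY]]].
    exists (A `&` A'), (B `&` B'); split; [exact: filterI|exact: filterI|].
    by move=> x [[Ax A'x] [Bx B'x]]; split; [exact: ABX|exact: ABY].
  + move=> X Y XY [A [B [MA NB ABX]]]; exists A, B; split=> //.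
    exact: subset_trans ABX XY.
- move=> X [A [B [MA NB ABX]]]; apply: ABX; split.
    exact: (linear_filter_mem0 linM MA).
  exact: (linear_filter_mem0 linN NB).
- move=> X [A [B [MA NB ABX]]].
  have [A' MA' AA'] := linear_filter_half linM MA.
  have [B' NB' BB'] := linear_filter_half linN NB.
  exists (A' `&` B'); first by exists A', B'; split.
  by move=> x y [A'x B'x] [A'y B'y]; apply: ABX; split; [exact: AA'|exact: BB'].
- move=> X x [A [B [MA NB ABX]]].
  apply: filterS (filterI (linear_filter_absorb linM x MA)
                          (linear_filter_absorb linN x NB)) => l.
  exact: ABX.
- move=> X l [A [B [MA NB ABX]]].
  exists [set x | A (l *: x)], [set x | B (l *: x)]; split.
  + exact: (linear_filterZ linM l MA).
  + exact: (linear_filterZ linN l NB).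
  + by move=> x; exact: ABX.
- move=> X [A [B [MA NB ABX]]].
  have [A' MA' AA'] := linear_filter_nearZ linM MA.
  have [B' NB' BB'] := linear_filter_nearZ linN NB.
  exists (A' `&` B'); first by exists A', B'; split.
  apply: filterS (filterI AA' BB') => l [lA lB] x [A'x B'x].
  by apply: ABX; split; [exact: lA|exact: lB].
Qed.

(* The trivial filter ensures that the union defining linear_core is not
   empty. *)
Let setT_linear : linear_filter [set [set: G]].
Proof.
split.
- split=> //; first by move=> A B -> ->; rewrite setIT.
  by move=> A B AB AT; apply/seteqP; split=> // x _; apply: AB; rewrite AT.
- by move=> V ->.
- by move=> V ->; exists setT.
- by move=> V x ->; exact: filterT.
- by move=> V l ->.
- by move=> V ->; exists setT => //; apply: filterS filterT => l _ x.
Qed.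

Lemma linear_core_linear : linear_filter linear_core.
Proof.
split.
- split.
  + by exists [set setT]; split=> // V ->; exact: filterT.
  + move=> A B [M [linM ME MA]] [N [linN NE NB]].
    exists (join M N); split; first exact: join_linear.
      move=> X [Y [Z [/ME EY /NE EZ YZX]]].
      exact: filterS YZX (filterI EY EZ).
    by exists A, B; split.
  + move=> A B AB [N [linN NE NA]]; exists N; split=> //.
    by have FN : Filter N := linN; exact: filterS NA.
- by move=> V [N [linN _ /(linear_filter_mem0 linN)]].
- move=> V [N [linN NE /(linear_filter_half linN)[W NW WV]]].
  by exists W => //; exists N.
- by move=> V x [N [linN _ /(linear_filter_absorb linN)]].
- move=> V l [N [linN NE /(linear_filterZ linN l)]].
  by exists N.
- move=> V [N [linN NE /(linear_filter_nearZ linN)[W NW WV]]].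
  by exists W => //; exists N.
Qed.

Definition core_topology : topology G :=
  translation_topology linear_core_linear.

Lemma core_topology_linear : linear_topology core_topology.
Proof. exact: translation_linear. Qed.

Lemma nbhs0_core V : nbhs ((0 : G) : carrier core_topology) V <-> linear_core V.
Proof.
split=> [/nbhs_translation|cV].
  by congr linear_core; apply/seteqP; split=> x /=; rewrite add0r.
apply/nbhs_translation; move: cV.
by congr linear_core; apply/seteqP; split=> x /=; rewrite add0r.
Qed.

Lemma nbhs0_core_sub V : nbhs ((0 : G) : carrier core_topology) V -> E V.
Proof. by move=> /nbhs0_core[N [_ NE /NE]]. Qed.

Lemma core_topology_finest (tau : topology G) : linear_topology tau ->
  (forall V, nbhs ((0 : G) : carrier tau) V -> E V) ->
  coarser tau core_topology.
Proof.
move=> ltau tauE; apply/(coarser_nbhs0 ltau core_topology_linear) => V tauV.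
apply/nbhs0_core; exists (nbhs ((0 : G) : carrier tau)); split=> //.
exact: linear_filter_nbhs.
Qed.

(** The linear filter generated by a closed string lies inside E by
    assumption, hence inside the core of E. *)
Lemma core_topology_barrelled :
  (forall U n, string U -> closed_string core_topology U -> (0 < n)%N ->
    E (U n)) ->
  barrelled core_topology.
Proof.
move=> EU; split=> [|U strU cU n n0]; first exact: core_topology_linear.
apply/nbhs0_core; exists (string_filter U); split.
- exact: string_filter_linear.
- by move=> V [m m0 UV]; exact: filterS UV (EU _ _ strU cU m0).
- by exists n.
Qed.

End linear_core.

(** * The associated barrelled topology *)

Section barrelled.
Context {R : realType}.
Implicit Types (G F : lmodType (gencplx R)).

(** The core of the intersection of the neighborhood filters of all barrelled
    topologies finer than tau. A string that is closed for this core is closed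
    for these finer topologies, hence topological for each of them. *)
Lemma associated_barrelled_exists G (tau : topology G) : linear_topology tau ->
  exists taut, associated_barrelled tau taut.
Proof.
move=> ltau.
pose E : set_system G := [set V : set G | forall sigma, barrelled sigma ->
  coarser tau sigma -> nbhs ((0 : G) : carrier sigma) V].
have FE : Filter E.
  split=> [sigma _ _|A B EA EB sigma bs ts|A B AB EA sigma bs ts].
  - exact: filterT.
  - by apply: filterI; [exact: EA|exact: EB].
  - by apply: filterS (EA _ bs ts); exact: AB.
have core_le sigma : barrelled sigma -> coarser tau sigma ->
    coarser (core_topology FE) sigma.
  move=> bs ts; apply/(coarser_nbhs0 (core_topology_linear FE) bs.1) => V.
  by move=> /nbhs0_core_sub; exact.
exists (core_topology FE); split=> //.
  apply: core_topology_barrelled => U n strU cU n0 sigma bs ts.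
  apply: bs.2 => // m m0; have := cU _ m0.
  by rewrite -!openC; exact: core_le.
apply: core_topology_finest => // V tauV sigma bs ts.
exact: (coarser_nbhs0 ltau bs.1).1 ts _ tauV.
Qed.

Lemma continuous_linear G F (sigma : topology G) (tau : topology F)
    (f : {linear G -> F}) : linear_topology sigma -> linear_topology tau ->
  (forall V, nbhs ((0 : F) : carrier tau) V ->
    nbhs ((0 : G) : carrier sigma) (f @^-1` V)) ->
  continuous_for sigma tau f.
Proof.
move=> ls lt fV x V /(nbhs_linear_translation (f x) V lt)/fV fxV.
apply/(nbhs_linear_translation x (f @^-1` V) ls); apply: filterS fxV => y /=.
by rewrite linearD.
Qed.

Lemma continuous_coarser G F (sigma : topology G) (tau tau' : topology F)
    (f : G -> F) :
  coarser tau tau' -> continuous_for sigma tau' f -> continuous_for sigma tau f.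
Proof.
by move=> tt' /continuousP cf; apply/continuousP => A /tt'; exact: cf.
Qed.

Lemma string_preimage G F (f : {linear G -> F}) (U : nat -> set F) :
  string U -> string (fun n => f @^-1` U n).
Proof.
move=> [bU hU mU]; split=> [n /bU[Ubal Uabs]|n n0 _ [u Uu [v Uv <-]]|n p n0 p0].
- split=> [l u l1 Uu|u]; first by rewrite /= linearZ; exact: Ubal.
  have [a Ua] := Uabs (f u); exists a => b /Ua[v Uv fuv].
  exists (epow (- b) *: u); last by rewrite scalerA epowVK scale1r.
  by rewrite /= linearZ /= -fuv scalerA mulrC epowVK scale1r.
- by rewrite /= linearD; apply: hU => //; exists (f u) => //; exists (f v).
- by move=> _ [u Uu <-]; rewrite /= linearZ; apply: (mU n) => //; exists (f u).
Qed.

(** The finest linear topology for which f is continuous is barrelled, and it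
    is finer than tau; so it is finer than taut. *)
Lemma continuous_associated_barrelled G F (sigma : topology G)
    (tau taut : topology F) (f : {linear G -> F}) :
  barrelled sigma -> linear_topology tau -> associated_barrelled tau taut ->
  continuous_for sigma tau f -> continuous_for sigma taut f.
Proof.
move=> bs lt [_ _ taut_le] cf.
pose E : set_system F := fmap f (nbhs ((0 : G) : carrier sigma)).
have FE : Filter E := fmap_filter f (linear_filter_nbhs bs.1).
have lrho := core_topology_linear FE.
have cfrho : continuous_for sigma (core_topology FE) f.
  by apply: continuous_linear bs.1 lrho _ => V /nbhs0_core_sub.
apply: (continuous_coarser _ cfrho); apply: taut_le.
  apply: core_topology_barrelled => U n strU cU n0.
  apply: bs.2 (string_preimage f strU) _ _ n0 => m m0.
  by apply: closed_comp (cU _ m0) => x _; exact: cfrho.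
apply: core_topology_finest => // V tauV; apply: (cf 0).
by rewrite linear0.
Qed.

End barrelled.

(** * The Hausdorff topology defined by a closed map *)

Section closed_map.
Context {R : realType} {G F : lmodType (gencplx R)}.
Variables (tau1 : topology G) (tau2 : topology F) (f : {linear G -> F}).
Hypotheses (ltau1 : linear_topology tau1) (ltau2 : linear_topology tau2).

Let N1 : set_system G := nbhs ((0 : G) : carrier tau1).
Let N2 : set_system F := nbhs ((0 : F) : carrier tau2).
Let lin1 : linear_filter N1 := linear_filter_nbhs ltau1.
Let lin2 : linear_filter N2 := linear_filter_nbhs ltau2.

(** The filter with base the sets f(U) + V. *)
Definition sum_filter : set_system F := [set X | exists U V,
  [/\ N1 U, N2 V & forall u v, U u -> V v -> X (f u + v)]].

Lemma sum_filter_linear : linear_filter sum_filter.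
Proof.
split.
- split.
  + by exists setT, setT; split=> //; exact: filterT.
  + move=> X Y [U [V [NU NV UVX]]] [U' [V' [NU' NV' UVY]]].
    exists (U `&` U'), (V `&` V'); split; [exact: filterI|exact: filterI|].
    by move=> u v [Uu U'u] [Vv V'v]; split; [exact: UVX|exact: UVY].
  + move=> X Y XY [U [V [NU NV UVX]]]; exists U, V; split=> // u v Uu Vv.
    exact/XY/UVX.
- move=> X [U [V [NU NV UVX]]]; rewrite -[0]addr0 -{1}(linear0 f).
  apply: UVX; first exact: (linear_filter_mem0 lin1 NU).
  exact: (linear_filter_mem0 lin2 NV).
- move=> X [U [V [NU NV UVX]]].
  have [U' NU' UU'] := linear_filter_half lin1 NU.
  have [V' NV' VV'] := linear_filter_half lin2 NV.
  exists [set x | exists u v, [/\ U' u, V' v & x = f u + v]].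
    by exists U', V'; split=> // u v U'u V'v; exists u, v.
  move=> _ _ [u [v [U'u V'v ->]]] [u' [v' [U'u' V'v' ->]]].
  by rewrite addrACA -linearD; apply: UVX; [exact: UU'|exact: VV'].
- move=> X x [U [V [NU NV UVX]]].
  apply: filterS (linear_filter_absorb lin2 x NV) => l Vlx /=.
  rewrite -[l *: x]add0r -(linear0 f).
  exact: UVX (linear_filter_mem0 lin1 NU) Vlx.
- move=> X l [U [V [NU NV UVX]]].
  exists [set u | U (l *: u)], [set v | V (l *: v)]; split.
  + exact: (linear_filterZ lin1 l NU).
  + exact: (linear_filterZ lin2 l NV).
  + by move=> u v Ulu Vlv; rewrite /= scalerDr -linearZ; exact: UVX.
- move=> X [U [V [NU NV UVX]]].
  have [U' NU' UU'] := linear_filter_nearZ lin1 NU.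
  have [V' NV' VV'] := linear_filter_nearZ lin2 NV.
  exists [set x | exists u v, [/\ U' u, V' v & x = f u + v]].
    by exists U', V'; split=> // u v U'u V'v; exists u, v.
  apply: filterS (filterI UU' VV') => l [lU lV] _ [u [v [U'u V'v ->]]].
  by rewrite scalerDr -linearZ; apply: UVX; [exact: lU|exact: lV].
Qed.

Definition sum_topology : topology F := translation_topology sum_filter_linear.

Lemma sum_topology_linear : linear_topology sum_topology.
Proof. exact: translation_linear. Qed.

Lemma nbhs0_sum V :
  nbhs ((0 : F) : carrier sum_topology) V -> sum_filter V.
Proof.
move=> /nbhs_translation.
by congr sum_filter; apply/seteqP; split=> x /=; rewrite add0r.
Qed.

Lemma sum_topology_coarser : coarser sum_topology tau2.
Proof.
apply/(coarser_nbhs0 sum_topology_linear ltau2) => X.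
move=> /nbhs0_sum[U [V [NU NV UVX]]]; apply: filterS NV => v Vv.
rewrite -[v]add0r -(linear0 f).
exact: UVX (linear_filter_mem0 lin1 NU) Vv.
Qed.

Lemma continuous_sum_topology : continuous_for tau1 sum_topology f.
Proof.
apply: continuous_linear ltau1 sum_topology_linear _ => X.
move=> /nbhs0_sum[U [V [NU NV UVX]]]; apply: filterS NU => u Uu /=.
rewrite -[f u]addr0; exact: UVX Uu (linear_filter_mem0 lin2 NV).
Qed.

(** If x is in f(U) + V for all U and V, then each U contains a u with
    x - f u in V; hence (0, x) adheres to the graph of f. *)
Lemma sum_topology_hausdorff : closed_map tau1 tau2 f -> hausdorff sum_topology.
Proof.
move=> cf; apply: translation_hausdorff => x Nx.
have /= := cf ((0 : G), x); rewrite linear0; apply=> B [[U W] /= [NU xW] UWB].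
have NW : N2 [set v : F | W (x - v)].
  have NxW : N2 [set v | W (x + v)].
    exact: (nbhs_linear_translation x W ltau2).1.
  by apply: filterS (linear_filterZ lin2 (-1) NxW) => v; rewrite /= scaleN1r.
have [u [v [Uu Wv xuv]]] : [set y | exists u v,
    [/\ U u, W (x - v) & y = f u + v]] x.
  by apply: Nx; exists U, [set v : F | W (x - v)]; split=> // u v Uu Wv;
    exists u, v.
exists (u, f u); split=> //=; apply: (UWB (u, f u)); split=> //=.
by move: Wv; rewrite {1}xuv addrK.
Qed.

End closed_map.

(** * Closed maps into infra-s modules *)

Theorem theorem3p21 (R : realType) (G F : lmodType (gencplx R))
    (tau1 : topology G) (tau2 : topology F) (f : {linear G -> F}) :
  barrelled tau1 -> infra_s tau2 ->
  closed_map tau1 tau2 f -> continuous_for tau1 tau2 f.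
Proof.
move=> btau1 [ltau2 _ infra] cf; have [ltau1 _] := btau1.
have lsum := sum_topology_linear f ltau1 ltau2.
have [taut staut] := associated_barrelled_exists lsum.
apply: (continuous_coarser (infra _ lsum _ _ _ staut)).
- exact: sum_topology_hausdorff.
- exact: sum_topology_coarser.
- apply: continuous_associated_barrelled btau1 lsum staut _.
  exact: continuous_sum_topology.
Qed.
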